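(* For every real number $r>1$, $$C_r \ge N_r+1 \ge \pi(r)+1.$$
   Context: For real $r>1$ and a positive integer $n$, $\sigma_{-r}(n)=\sum_{d\mid n} d^{-r}$, the sum being over positive divisors of $n$. $C_r$ denotes the number of connected components of $\overline{\sigma_{-r}(\mathbb{N})}$, the topological closure in $\mathbb{R}$ of the range $\{\sigma_{-r}(n): n\in\mathbb{N}\}$, where $\mathbb{N}=\{1,2,\dots\}$. Let $p_m$ denote the $m$th prime ($p_1=2$). The prime $p_m$ is called $r$-mighty if $1+p_m^{-r}>\prod_{t=m+1}^\infty \frac{1}{1-p_t^{-r}}$. $N_r$ is the number of $r$-mighty primes, and $\pi(x)$ is the number of primes $p\le x$. *)

(* Defs.v *)
From HB Require Import structures.
From mathcomp Require Import all_boot all_order all_algebra.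
From mathcomp Require Import all_classical all_reals all_analysis.

Set Implicit Arguments.
Unset Strict Implicit.
Unset Printing Implicit Defensive.

Import Order.TTheory GRing.Theory Num.Theory.
Import numFieldNormedType.Exports.

Local Open Scope classical_set_scope.
Local Open Scope ring_scope.

Definition next_prime_ex (n : nat) : exists p, ((n < p) && prime p)%N :=
  let: exist2 p np pp := prime_above n in ex_intro _ p (introT andP (conj np pp)).

Definition next_prime (n : nat) : nat := ex_minn (next_prime_ex n).

(* 1-based: [nth_prime 1 = 2]; the value [nth_prime 0 = 0] is junk. *)
Definition nth_prime (m : nat) : nat := iter m next_prime 0%N.

Section Sigma.
Variable R : realType.
Implicit Types r x : R.

(* [sigmaN r] is sigma_{-r}, with the exponent negated. *)
Definition sigmaN r (n : nat) : R :=
  \sum_(d <- divisors n) (d%:R : R) `^ (- r).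

Definition components (A : set R) : set (set R) :=
  [set connected_component A x | x in A].

(* Cardinalities are taken with [counting], hence in [\bar R] and equal to
   [+oo] on infinite sets, so that no finiteness is presupposed. *)

Definition num_components r : \bar R :=
  counting (components (closure [set sigmaN r n | n in [set n | (0 < n)%N]])).

Definition prime_tail_product r (m : nat) : R :=
  limn (fun n => \prod_(m.+1 <= t < n) (1 - ((nth_prime t)%:R : R) `^ (- r))^-1).

Definition mighty r (p : nat) : Prop :=
  exists m : nat, [/\ (0 < m)%N, p = nth_prime m &
    1 + (p%:R : R) `^ (- r) > prime_tail_product r m].

Definition num_mighty r : \bar R := counting [set p | mighty r p].

Definition prime_pi x : \bar R := counting [set p | prime p /\ (p%:R : R) <= x].

End Sigma.

(* Main.v *)
Require Import Defs.
From mathcomp Require Import all_boot all_order all_algebra.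
From mathcomp Require Import all_classical all_reals all_analysis.
From mathcomp Require Import zify ring lra.

Import Order.TTheory GRing.Theory Num.Theory.
Import numFieldNormedType.Exports.
Local Open Scope ring_scope.

(** Call [k] y-rough when every prime factor of [k] exceeds [y], and let
    [rough_zeta y] be the sum of [k ^ -r] over all y-rough [k].  By the Euler
    product, [rough_zeta p_m] is the product of [1 / (1 - p_t ^ -r)] over
    [t > m], so [p] is mighty exactly when [rough_zeta p < 1 + p ^ -r].

    Each mighty prime creates a gap.  The divisors of a p-rough [n] are p-rough,
    so [sigma n <= rough_zeta p]; any other [n] has a prime divisor [q <= p], so
    [sigma n >= 1 + q ^ -r >= 1 + p ^ -r].  Hence no value of sigma, and no
    limit of values, lies strictly between [rough_zeta p] and [1 + p ^ -r].
    Now [sigma p] lies above this gap, while [sigma 1] and [sigma q], for [q] a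
    prime larger than [p], lie below it because [1] and [q] are p-rough.  So the
    components of [sigma 1] and of [sigma p], [p] mighty, are pairwise distinct
    ([mighty_component_inj]), which gives the first inequality, whether or not
    these cardinals are finite.

    For the second inequality, let [p <= r].  A p-rough [k] other than [1] is
    odd and larger than [p], and [k ^ -r <= p ^ -r (p / k) ^ p] because
    [r >= p].  It therefore suffices that the sum of [(p / k) ^ p] over odd
    [k > p] is less than [1].  By convexity [k ^ -p] is less than the mean of
    [x ^ -p] over the interval from [k - 1] to [k + 1], so the sum telescopes to
    less than [p / (2 (p - 1)) <= 1] ([rough_zeta_lt_mighty]).

    The Euler product is proved by sieving: removing the multiples of the next
    prime [q] multiplies the sum over y-rough numbers by [1 - q ^ -r]. *)

(** * The enumeration of the primes *)

Lemma next_primeP (y : nat) :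
  [/\ (y < next_prime y)%N, prime (next_prime y) &
      forall p : nat, prime p -> (y < p)%N -> (next_prime y <= p)%N].
Proof.
rewrite /next_prime; case: ex_minnP => q /andP[yq pq] qmin.
by split=> // p pp yp; apply: qmin; rewrite yp.
Qed.

Lemma nth_primeS (m : nat) : nth_prime m.+1 = next_prime (nth_prime m).
Proof. by rewrite /nth_prime iterS. Qed.

Lemma prime_nth_prime (m : nat) : (0 < m)%N -> prime (nth_prime m).
Proof.
by case: m => // m _; rewrite nth_primeS; case: (next_primeP (nth_prime m)).
Qed.

Lemma nth_prime_ltn (m n : nat) : (m < n)%N -> (nth_prime m < nth_prime n)%N.
Proof.
apply: (homo_ltn (f := nth_prime) (r := fun a b => a < b)%N) => [? ? ?|i].
  exact: ltn_trans.
by rewrite nth_primeS; case: (next_primeP (nth_prime i)).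
Qed.

Lemma leq_nth_prime (m : nat) : (m <= nth_prime m)%N.
Proof.
by elim: m => // m IH; exact: leq_ltn_trans IH (nth_prime_ltn _ _ (ltnSn m)).
Qed.

Lemma nth_prime_onto (p : nat) :
  prime p -> exists2 m : nat, (0 < m)%N & nth_prime m = p.
Proof.
move=> pp; have ex : exists m, (p <= nth_prime m)%N by exists p; exact: leq_nth_prime.
case: (ex_minnP ex) => -[|m] pm mmin.
  by have := prime_gt0 pp; rewrite ltnNge pm.
exists m.+1 => //; apply/eqP; rewrite eqn_leq pm andbT nth_primeS.
have [_ _] := next_primeP (nth_prime m); apply=> //.
by rewrite ltnNge; apply/negP => /mmin; rewrite ltnn.
Qed.

(** * Rough numbers *)

Definition rough (y k : nat) : bool := all (fun p => y < p)%N (primes k).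

Lemma roughP (y k : nat) : (0 < k)%N ->
  reflect (forall p : nat, prime p -> (p %| k)%N -> (y < p)%N) (rough y k).
Proof.
move=> k0; apply: (iffP allP) => [h p pp pk|h p].
  by apply: h; rewrite mem_primes pp k0.
by rewrite mem_primes => /and3P[pp _ pk]; exact: h.
Qed.

Lemma rough_prime (y p : nat) : prime p -> rough y p = (y < p)%N.
Proof. by move=> pp; rewrite /rough primes_prime//= andbT. Qed.

Lemma rough_dvd (y d n : nat) : (0 < n)%N -> (d %| n)%N -> rough y n -> rough y d.
Proof.
move=> n0 dn /(roughP _ _ n0) h; apply/roughP; first exact: dvdn_gt0 n0 dn.
by move=> p pp pd; apply: h => //; exact: dvdn_trans dn.
Qed.

Lemma roughM (y p k : nat) : prime p -> (y < p)%N -> (0 < k)%N ->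
  rough y (p * k) = rough y k.
Proof.
move=> pp yp k0; apply/idP/idP.
  by apply: rough_dvd; rewrite ?dvdn_mull// muln_gt0 prime_gt0.
move=> /(roughP _ _ k0) h; apply/roughP; first by rewrite muln_gt0 prime_gt0.
move=> q qq; rewrite Euclid_dvdM// dvdn_prime2// => /orP[/eqP->//|]; exact: h.
Qed.

(** The sieve step at the level of predicates: no prime lies strictly between
    [y] and [next_prime y]. *)
Lemma rough_next_prime (y k : nat) : (0 < k)%N ->
  rough (next_prime y) k = rough y k && ~~ (next_prime y %| k)%N.
Proof.
move=> k0; have [yq pq qmin] := next_primeP y.
apply/(roughP _ _ k0)/andP => [h|[/(roughP _ _ k0) h nqk] p pp pk].
  split; first by apply/roughP => // p pp pk; exact: ltn_trans (h p pp pk).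
  by apply/negP => /(h _ pq); rewrite ltnn.
rewrite ltn_neqAle qmin ?h// andbT; apply: contraNneq nqk => ->//.
Qed.

(** Up to [y] the number [1] is the only y-rough one, so a sum over y-rough
    numbers consists of [1] and a tail beyond [y]. *)
Lemma rough_leq (y k : nat) : (0 < k <= y)%N -> rough y k = (k == 1)%N.
Proof.
move=> /andP[k0 ky]; apply/idP/eqP => [/(roughP _ _ k0) h|->//].
apply/eqP; rewrite eqn_leq k0 andbT leqNgt; apply/negP => k1.
have := h _ (pdiv_prime k1) (pdiv_dvd k).
by rewrite ltnNge (leq_trans (pdiv_leq k0) ky).
Qed.

(** * Sums over rough numbers and the Euler product *)

Section RoughSum.
Variables (R : realType) (r : R).
Hypothesis r1 : 1 < r.

Let r_gt0 : 0 < r.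
Proof. exact: lt_trans ltr01 r1. Qed.

Definition npow (k : nat) : R := (k%:R : R) `^ (- r).

Lemma npow_gt0 (k : nat) : (0 < k)%N -> 0 < npow k.
Proof. by move=> k0; rewrite powR_gt0// ltr0n. Qed.

Lemma npow1 : npow 1 = 1.
Proof. by rewrite /npow powR1. Qed.

Lemma npowM (a b : nat) : npow (a * b) = npow a * npow b.
Proof. by rewrite /npow natrM powRM. Qed.

Lemma npow_le (a b : nat) : (0 < a <= b)%N -> npow b <= npow a.
Proof.
move=> /andP[a0 ab]; rewrite /npow !powRN lef_pV2 ?posrE ?powR_gt0 ?ltr0n//; last lia.
by apply: ge0_ler_powR; rewrite ?nnegrE ?ler_nat// ltW ?r_gt0.
Qed.

Lemma npow_lt1 (a : nat) : (1 < a)%N -> npow a < 1.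
Proof.
move=> a1; rewrite /npow powRN invf_lt1 ?powR_gt0 ?ltr0n; [|lia..].
have e : (1 : R) `^ r = 1 by rewrite powR1.
rewrite -[ltLHS]e.
by apply: gt0_ltr_powR; rewrite ?nnegrE ?ltr1n ?r_gt0.
Qed.

Definition rough_sum (y N : nat) : R := \sum_(1 <= k < N.+1 | rough y k) npow k.

Lemma rough_sumS (y N : nat) :
  rough_sum y N.+1 = rough_sum y N + (if rough y N.+1 then npow N.+1 else 0).
Proof. by rewrite /rough_sum big_mkcond big_nat_recr//= -big_mkcond. Qed.

Lemma rough_sum0 (y : nat) : rough_sum y 0 = 0.
Proof. by rewrite /rough_sum big_geq. Qed.

Lemma rough_sum_le (y M N : nat) : (M <= N)%N -> rough_sum y M <= rough_sum y N.
Proof.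
apply: (homo_leq (f := rough_sum y) (r := fun a b => a <= b)) => [//|? ? ?|i].
  exact: le_trans.
by rewrite rough_sumS lerDl; case: ifP => // _; rewrite ltW ?npow_gt0.
Qed.

Lemma rough_sum_le_base (y N : nat) : rough_sum y N <= rough_sum 0 N.
Proof.
elim: N => [|N IH]; first by rewrite !rough_sum0.
rewrite !rough_sumS lerD//.
have -> : rough 0 N.+1 by apply/roughP => // p /prime_gt0.
by case: ifP => // _; rewrite ltW ?npow_gt0.
Qed.

Lemma rough_sum_small (y N : nat) : (0 < N <= y)%N -> rough_sum y N = 1.
Proof.
case: N => // N /= Ny; rewrite /rough_sum big_ltn_cond//= big_nat_cond.
rewrite big1 ?addr0 ?npow1//.
by move=> k /andP[/andP[k1 kN]]; rewrite rough_leq; lia.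
Qed.

Lemma rough_sum_ge1 (y N : nat) : (0 < N)%N -> 1 <= rough_sum y N.
Proof.
move=> N0; apply: le_trans (rough_sum_le y 1 N N0).
by rewrite rough_sumS rough_sum0 /= npow1 add0r.
Qed.

(** Every y-rough number is either q-rough or [q] times a y-rough number, where
    [q] is the prime following [y]. *)
Lemma sieve (y N : nat) : rough_sum y N =
  rough_sum (next_prime y) N +
  npow (next_prime y) * rough_sum y (N %/ next_prime y).
Proof.
have [yq pq qmin] := next_primeP y; set q := next_prime y in yq pq qmin *.
elim: N => [|N IH]; first by rewrite div0n !rough_sum0 mulr0 addr0.
rewrite divnS ?prime_gt0// !rough_sumS IH rough_next_prime// -/q.
have [qN|qN] /= := boolP (q %| N.+1)%N; last by rewrite andbT; ring.
rewrite andbF add1n rough_sumS.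
have -> : N.+1 = (q * (N %/ q).+1)%N.
  by have := divnS N (prime_gt0 pq); rewrite qN add1n => <-; rewrite mulnC divnK.
rewrite roughM// npowM; case: ifP => _; ring.
Qed.

(** Among [2, ..., 2 M + 1], each odd term is at most the even term before it,
    and the even terms add up to [2 ^ -r] times the sum up to [M].  So the sum
    [S] of all terms satisfies [S N <= S (2 N + 1) <= 1 + 2 ^ (1 - r) * S N],
    which bounds [S N] because [2 ^ (1 - r) < 1]. *)
Lemma rough_sum_bounded (y N : nat) : rough_sum y N <= (1 - 2 * npow 2)^-1.
Proof.
have x0 : 0 < npow 2 by exact: npow_gt0.
have x1 : 2 * npow 2 < 1.
  rewrite /npow powRN ltr_pdivrMr ?powR_gt0 ?ltr0n// mul1r -[ltLHS]powRr1//.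
  by rewrite /powR !pnatr_eq0/= ltr_expR ltr_pM2r ?ln_gt0 ?ltr1n.
suff S0 : rough_sum 0 N <= (1 - 2 * npow 2)^-1.
  exact: le_trans (rough_sum_le_base _ _) S0.
have step M : rough_sum 0 M.*2.+1 <= 1 + 2 * npow 2 * rough_sum 0 M.
  have r0 k : rough 0 k by apply/allP => p; rewrite mem_primes => /andP[/prime_gt0].
  elim: M => [|M IH]; first by rewrite rough_sumS !rough_sum0 r0 npow1; lra.
  rewrite doubleS !(rough_sumS _ _.+1) (rough_sumS _ M) !r0.
  have e : npow M.*2.+2 = npow 2 * npow M.+1 by rewrite -npowM mul2n doubleS.
  have := npow_le M.*2.+2 M.*2.+3 (leqnSn _); rewrite e; lra.
have := le_trans (rough_sum_le 0 N N.*2.+1 _) (step N) => /(_ ltac:(lia)) h.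
rewrite -[leRHS]mul1r ler_pdivlMr; lra.
Qed.

Definition rough_zeta (y : nat) : R := sup (range (rough_sum y)).

Lemma rough_zeta_ub (y N : nat) : rough_sum y N <= rough_zeta y.
Proof.
apply: ub_le_sup; last by exists N.
by exists (1 - 2 * npow 2)^-1 => _ [M _ <-]; exact: rough_sum_bounded.
Qed.

Lemma rough_zeta_le (y : nat) (C : R) :
  (forall N, rough_sum y N <= C) -> rough_zeta y <= C.
Proof.
by move=> h; apply: ge_sup; [exists (rough_sum y 0), 0%N|move=> _ [N _ <-]].
Qed.

(** The two terms of [sieve] have different ranges of summation; passing to the
    supremum makes the relation homogeneous. *)
Lemma rough_zeta_sieve (y : nat) :
  rough_zeta (next_prime y) = (1 - npow (next_prime y)) * rough_zeta y.
Proof.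
have [yq pq qmin] := next_primeP y; set q := next_prime y in yq pq qmin *.
have x0 : 0 < npow q by rewrite npow_gt0 ?prime_gt0.
apply/eqP; rewrite eq_le mulrBl mul1r; apply/andP; split.
  apply: rough_zeta_le => N; rewrite lerBrDr -lerBrDl mulrC -ler_pdivlMr//.
  apply: rough_zeta_le => M; rewrite ler_pdivlMr// lerBrDl mulrC.
  apply: le_trans (rough_zeta_ub y (maxn N (q * M))).
  rewrite [leRHS]sieve -/q lerD ?ler_pM2l// ?rough_sum_le ?leq_maxl//.
  by rewrite leq_divRL ?prime_gt0// mulnC leq_maxr.
rewrite lerBlDr; apply: rough_zeta_le => N.
by rewrite sieve -/q lerD ?ler_pM2l// rough_zeta_ub.
Qed.

Lemma rough_zeta_ge1 (y : nat) : 1 <= rough_zeta y.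
Proof. exact: le_trans (rough_sum_ge1 y 1 isT) (rough_zeta_ub y 1). Qed.

Definition euler_factor (t : nat) : R := (1 - npow (nth_prime t))^-1.

Lemma euler_factor_ge1 (t : nat) : (0 < t)%N -> 1 <= euler_factor t.
Proof.
move=> t0; have pp := prime_nth_prime t t0.
have := npow_lt1 _ (prime_gt1 pp); have := npow_gt0 _ (prime_gt0 pp).
by move=> x0 x1; rewrite invf_ge1; lra.
Qed.

Lemma euler_prod_ge0 (m n : nat) : 0 <= \prod_(m.+1 <= t < n) euler_factor t.
Proof.
rewrite big_nat prodr_ge0// => t /andP[mt _].
by apply: le_trans ler01 _; apply: euler_factor_ge1; lia.
Qed.

(** As the last factor is at least [1], this bounds the partial products from
    above by [rough_zeta]. *)
Lemma rough_zeta_euler (m n : nat) : (m <= n)%N ->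
  rough_zeta (nth_prime m) =
  (\prod_(m.+1 <= t < n.+1) euler_factor t) * rough_zeta (nth_prime n).
Proof.
move=> /subnKC <-; elim: (n - m)%N => [|k IH].
  by rewrite addn0 big_geq// mul1r.
rewrite !addnS big_nat_recr ?ltnS ?leqW ?leq_addr//= IH -mulrA; congr (_ * _).
have pp := prime_nth_prime (m + k).+1 isT.
rewrite rough_zeta_sieve -nth_primeS mulrA mulVf ?mul1r//.
by have := npow_lt1 _ (prime_gt1 pp) => ?; rewrite subr_eq0 gt_eqF.
Qed.

(** Once [nth_prime n >= N] the last factor is [1], so this bounds the partial
    sums from above by the partial products. *)
Lemma rough_sum_euler (m n N : nat) : (m <= n)%N ->
  rough_sum (nth_prime m) N <=
  (\prod_(m.+1 <= t < n.+1) euler_factor t) * rough_sum (nth_prime n) N.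
Proof.
move=> /subnKC <-; elim: (n - m)%N => [|k IH].
  by rewrite addn0 big_geq// mul1r.
rewrite !addnS big_nat_recr ?ltnS ?leqW ?leq_addr//=.
apply: le_trans IH _; rewrite -mulrA ler_wpM2l//.
  exact: euler_prod_ge0.
have pp := prime_nth_prime (m + k).+1 isT.
have x0 := npow_gt0 _ (prime_gt0 pp); have x1 := npow_lt1 _ (prime_gt1 pp).
rewrite /euler_factor mulrC ler_pdivlMr ?subr_gt0// mulrBr mulr1 lerBlDr.
rewrite [leLHS]sieve -nth_primeS lerD2l mulrC ler_wpM2r// ?(ltW x0)//.
by rewrite rough_sum_le// leq_div.
Qed.

Lemma euler_product (m : nat) :
  prime_tail_product r m = rough_zeta (nth_prime m).
Proof.
pose u n := \prod_(m.+1 <= t < n) euler_factor t.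
have u_nd : nondecreasing_seq u.
  apply/nondecreasing_seqP => n; rewrite /u.
  have [mn|nm] := leqP m.+1 n; last by rewrite !big_geq ?lexx// ltnW.
  rewrite big_nat_recr//= ler_peMr ?euler_factor_ge1//; last by lia.
  exact: euler_prod_ge0.
have u_le n : u n <= rough_zeta (nth_prime m).
  apply: le_trans (u_nd _ (maxn m n).+1 (leqW (leq_maxr m n))) _.
  rewrite (rough_zeta_euler m (maxn m n)) ?leq_maxl// ler_peMr ?rough_zeta_ge1//.
  exact: euler_prod_ge0.
have u_ub : has_ubound (range u) by exists (rough_zeta (nth_prime m)) => _ [n _ <-].
rewrite /prime_tail_product (cvg_lim _ (nondecreasing_cvgn u_nd u_ub))//.
apply/eqP; rewrite eq_le; apply/andP; split.
  by apply: ge_sup; [exists (u 0%N), 0%N|move=> _ [n _ <-]].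
apply: rough_zeta_le => -[|N].
  rewrite rough_sum0; apply: le_trans (ub_le_sup u_ub (ex_intro2 _ _ 0%N I erefl)).
  by rewrite /u big_geq.
pose n := maxn m N.+1.
apply: le_trans (ub_le_sup u_ub (ex_intro2 _ _ n.+1 I erefl)).
apply: le_trans (rough_sum_euler m n N.+1 (leq_maxl _ _)) _.
rewrite rough_sum_small ?mulr1//=.
exact: leq_trans (leq_maxr m N.+1) (leq_nth_prime _).
Qed.

(** * The gap below the value at a prime *)

Lemma sigmaN_sum (n : nat) : (0 < n)%N ->
  sigmaN r n = \sum_(1 <= d < n.+1 | (d %| n)%N) npow d.
Proof.
move=> n0; rewrite -big_filter /sigmaN; apply: perm_big.
apply: uniq_perm; rewrite ?divisors_uniq ?filter_uniq ?iota_uniq// => d.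
rewrite mem_filter -dvdn_divisors// mem_index_iota andbC.
case dn: (d %| n)%N; last by rewrite andbF.
by rewrite andbT; have := dvdn_gt0 n0 dn; have := dvdn_leq n0 dn; lia.
Qed.

Lemma sigmaN_rough_le (y n : nat) : (0 < n)%N -> rough y n ->
  sigmaN r n <= rough_zeta y.
Proof.
move=> n0 rn; apply: le_trans (rough_zeta_ub y n).
rewrite sigmaN_sum// /rough_sum big_mkcond [leRHS]big_mkcond.
apply: ler_sum_nat => d /andP[d0 _].
have [dn|_] := boolP (d %| n)%N; first by rewrite (rough_dvd _ _ _ n0 dn rn).
by case: ifP => // _; rewrite ltW ?npow_gt0.
Qed.

Lemma sigmaN_ge (q n : nat) : (0 < n)%N -> prime q -> (q %| n)%N ->
  1 + npow q <= sigmaN r n.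
Proof.
move=> n0 pq qn; have [q0 q1] := (prime_gt0 pq, prime_gt1 pq).
rewrite sigmaN_sum// big_ltn_cond ?ltnS// dvd1n npow1 lerD2l.
have qin : q \in index_iota 2 n.+1 by rewrite mem_index_iota q1 ltnS dvdn_leq.
rewrite big_mkcond (bigD1_seq q qin (iota_uniq _ _)).
rewrite /= qn lerDl.
by apply: sumr_ge0 => d _; case: ifP => // _; exact: powR_ge0.
Qed.

(** If [n] is not p-rough, it has a prime divisor [q <= p], and the divisors [1]
    and [q] alone contribute [1 + q ^ -r]. *)
Lemma sigmaN_gap (p n : nat) : prime p -> (0 < n)%N ->
  sigmaN r n <= rough_zeta p \/ 1 + npow p <= sigmaN r n.
Proof.
move=> pp n0; have [rn|/allPn[q]] := boolP (rough p n).
  by left; exact: sigmaN_rough_le.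
rewrite mem_primes -leqNgt => /and3P[pq _ qn] qp; right.
by apply: le_trans (sigmaN_ge q n n0 pq qn); rewrite lerD2l npow_le// prime_gt0.
Qed.

End RoughSum.

(** * Components separated by a gap *)

Lemma closure_gap (R : realType) (A : set R) (l h c : R) : l < c < h ->
  (forall x, A x -> x <= l \/ h <= x) -> ~ closure A c.
Proof.
move=> /andP[lc ch] Agap /(_ `]l, h[%classic) [].
  by apply: near_in_itvoo; rewrite in_itv/= lc.
move=> x [/Agap]; rewrite /= in_itv/= => -[xl|hx] /andP[].
  by rewrite ltNge xl.
by rewrite [x < h]ltNge hx.
Qed.

(** Components of a subset of the line are intervals, so one component containing
    both [x] and [y] would contain the midpoint of the gap. *)
Lemma component_gap (R : realType) (A : set R) (l h x y : R) :
  x <= l -> l < h -> h <= y -> closure A y ->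
  (forall z, A z -> z <= l \/ h <= z) ->
  connected_component (closure A) x <> connected_component (closure A) y.
Proof.
move=> xl lh hy Ay Agap e.
have [Ax|nAx] := pselect (closure A x); last first.
  have := connected_component_refl Ay.
  by rewrite -e connected_component_out.
have Cx := connected_component_refl Ax.
have Cy := connected_component_refl Ay; rewrite -e in Cy.
have /connected_intervalP CI := @component_connected _ (closure A) x.
have lch : l < (l + h) / 2 < h by apply/andP; split; lra.
apply: (closure_gap _ _ _ _ _ lch Agap).
apply: (connected_component_sub (x := x)); apply: (CI _ _ Cx Cy).
by apply/andP; split; lra.
Qed.

(** * Counting as a cardinal *)

Lemma counting_card_le (R : realType) (T U : choiceType) (A : set T) (B : set U) :
  (A #<= B)%card -> (counting A <= counting B :> \bar R)%E.
Proof.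
move=> AB; rewrite /counting; case: asboolP => fA; case: asboolP => fB //.
- rewrite lee_fin ler_nat; have /finite_setP[n Bn] := fB.
  rewrite (card_fset_set Bn) geq_card_fset_set//.
  by rewrite -(card_le_eqr Bn).
- by rewrite leey.
- by case: fA; exact: card_le_finite AB fB.
Qed.

Lemma counting_add1 (R : realType) (T : choiceType) (x : T) (A : set T) :
  ~ A x -> (counting (x |` A) = counting A + 1 :> \bar R)%E.
Proof.
move=> Ax; rewrite /counting; case: asboolP => fA.
  have fA' : finite_set A by apply: sub_finite_set fA.
  rewrite asboolT// -EFinD natr1 fset_setU// fset_set1 finmap.cardfsU1.
  by rewrite in_fset_set// memNset//= add1n.
rewrite asboolF ?addye// => fA'; apply: fA.
by rewrite finite_setU; split.
Qed.

(** * Primes up to the exponent are mighty *)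

(** The left side is the first odd term in the binomial expansion of the
    difference.  The powers [x ^ a.-1] are avoided by multiplying by [x]; the
    induction also carries the matching bound for the sum of the two powers. *)
Lemma binomial_odd_part_ge (R : realDomainType) (x : R) (a : nat) : 1 <= x ->
  2 * a%:R * x ^+ a <= x * ((x + 1) ^+ a - (x - 1) ^+ a).
Proof.
move=> x1; suff [] : 2 * x ^+ a <= (x + 1) ^+ a + (x - 1) ^+ a /\
  2 * a%:R * x ^+ a <= x * ((x + 1) ^+ a - (x - 1) ^+ a) by [].
elim: a => [|a [IHs IHd]]; first by rewrite !expr0; split; lra.
have d0 : (x - 1) ^+ a <= (x + 1) ^+ a.
  by apply: lerXn2r; rewrite ?nnegrE; lra.
have xs : x * (2 * x ^+ a) <= x * ((x + 1) ^+ a + (x - 1) ^+ a).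
  by rewrite ler_wpM2l//; lra.
have xd : x * (2 * a%:R * x ^+ a) <= x * (x * ((x + 1) ^+ a - (x - 1) ^+ a)).
  by rewrite ler_wpM2l//; lra.
rewrite !exprS -(natr1 a); move: xs xd d0.
move: (x ^+ a) ((x + 1) ^+ a) ((x - 1) ^+ a) (a%:R) => X P M A xs xd d0.
split; lra.
Qed.

(** The right side is the mean of [t ^ -(a+1)] over the interval from [x - 1] to
    [x + 1], so this is the midpoint inequality for a convex function. *)
Lemma inv_expr_lt_telescope (R : realFieldType) (x : R) (a : nat) :
  (0 < a)%N -> 1 < x ->
  (x ^+ a.+1)^-1 < (2 * a%:R)^-1 * ((x - 1) ^- a - (x + 1) ^- a).
Proof.
move=> a0 x1; have := binomial_odd_part_ge R x a (ltW x1).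
have A0 : 0 < 2 * a%:R :> R by rewrite mulr_gt0// ltr0n.
have M0 : 0 < (x - 1) ^+ a by rewrite exprn_gt0//; lra.
have P0 : 0 < (x + 1) ^+ a by rewrite exprn_gt0//; lra.
have X0 : 0 < x ^+ a by rewrite exprn_gt0//; lra.
have MP : (x - 1) ^+ a * (x + 1) ^+ a < x ^+ a * x ^+ a.
  by rewrite -!exprMn ltrXn2r// ?nnegrE -?lt0n//; nra.
rewrite exprS; move: A0 M0 P0 X0 MP.
move: (x ^+ a) ((x + 1) ^+ a) ((x - 1) ^+ a) (2 * a%:R) => X P M A A0 M0 P0 X0 MP D.
have -> : A^-1 * (M^-1 - P^-1) = (P - M) / (A * (M * P)) by field; rewrite ?gt_eqF.
rewrite ltr_pdivlMr ?mulr_gt0// mulrC ltr_pdivrMr ?mulr_gt0//; last lra.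
have : A * (M * P) < A * (X * X) by rewrite ltr_pM2l.
have : X * (A * X) <= X * (x * (P - M)) by rewrite ler_pM2l.
lra.
Qed.

(** The prime in question is written [a.+1], since the exponent [a] of the
    telescoping terms is one less than it. *)
Section Mighty.
Variables (R : realType) (r : R) (a : nat).
Hypotheses (r1 : 1 < r) (a0 : (0 < a)%N) (ar : a.+1%:R <= r).
Local Notation p := a.+1.

Lemma npow_ratio_le (n : nat) : (p <= n)%N ->
  npow R r n <= npow R r p * (p%:R ^+ p / n%:R ^+ p).
Proof.
move=> pn; have p0 : 0 < p%:R :> R by rewrite ltr0n.
have n0 : 0 < n%:R :> R by rewrite ltr0n; lia.
have e : n%:R = p%:R * (n%:R / p%:R) :> R by rewrite mulrC divfK// gt_eqF.
rewrite {1}/npow {1}e powRM ?(ltW p0) ?divr_ge0 ?(ltW n0) ?(ltW p0)//.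
apply: ler_wpM2l; first exact: powR_ge0.
have -> : p%:R ^+ p / n%:R ^+ p = (n%:R / p%:R) `^ (- p%:R) :> R.
  by rewrite powRN powR_mulrn ?divr_ge0 ?(ltW n0) ?(ltW p0)// expr_div_n invf_div.
by apply: ler_powR; rewrite ?lerN2// ler_pdivlMr// mul1r ler_nat.
Qed.

(** The integral of [(p / x) ^ p / 2] from [2 * uphalf N] to infinity, hence a
    bound for the sum of [(p / k) ^ p] over odd [k > N]: each such [k] is the
    midpoint of an interval of length [2], and [2 * uphalf N] is the left end
    of the first of these intervals. *)
Definition tail_majorant (N : nat) : R :=
  p%:R ^+ p / (2 * a%:R) / (uphalf N).*2%:R ^+ a.

(** A partial sum over p-rough numbers plus a bound for what remains. *)
Definition potential (N : nat) : R :=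
  rough_sum R r p N + npow R r p * tail_majorant N.

(** Passing an odd number replaces a piece of the majorant by a strictly smaller
    term. *)
Lemma potentialS_lt (j : nat) : (p <= j.*2)%N ->
  potential j.*2.+1 < potential j.*2.
Proof.
move=> pj; have p0 := npow_gt0 R r p isT.
rewrite /potential rough_sumS.
have le1 : (if rough p j.*2.+1 then npow R r j.*2.+1 else 0) <=
    npow R r p * (p%:R ^+ p / j.*2.+1%:R ^+ p).
  case: ifP => _; first by apply: npow_ratio_le; lia.
  by rewrite mulr_ge0 ?(ltW p0)// divr_ge0// exprn_ge0.
suff lt2 : p%:R ^+ p / j.*2.+1%:R ^+ p <
    tail_majorant j.*2 - tail_majorant j.*2.+1.
  rewrite -addrA ltrD2l -ltrBrDr -mulrBr; apply: le_lt_trans le1 _.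
  by rewrite ltr_pM2l.
have x1 : 1 < j.*2.+1%:R :> R by rewrite ltr1n; lia.
have lt := inv_expr_lt_telescope R _ a a0 x1.
have P0 : 0 < p%:R ^+ p :> R by rewrite exprn_gt0// ltr0n.
rewrite -(ltr_pM2l P0) in lt.
apply: lt_le_trans lt _.
rewrite /tail_majorant uphalf_double /= doubleK doubleS.
rewrite -(natr1 j.*2) addrK -addrA -[1 + 1]/(2%:R) -natrD addn2.
by rewrite le_eqVlt; apply/orP; left; apply/eqP; ring.
Qed.

(** Odd numbers lower the potential; even ones are not p-rough and lie inside an
    interval already accounted for, so they leave it unchanged. *)
Lemma potential_le (M N : nat) : (p <= M <= N)%N ->
  potential N <= potential M.
Proof.
move=> /andP[pM /subnKC <-]; elim: (N - M)%N => [|k IH]; first by rewrite addn0.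
apply: le_trans IH; rewrite addnS; set K := (M + k)%N.
have pK : (p <= K)%N by rewrite /K; lia.
have [oK|eK] := boolP (odd K); last first.
  by rewrite -(even_uphalfK eK); apply/ltW/potentialS_lt; rewrite even_uphalfK.
rewrite /potential rough_sumS.
have -> : rough p K.+1 = false.
  apply/negbTE/negP => /(roughP _ _ (ltn0Sn _)) /(_ 2 isT).
  by rewrite dvdn2 /= oK => /(_ isT); lia.
rewrite addr0 /tail_majorant.
suff -> : uphalf K.+1 = uphalf K by [].
by rewrite uphalfE /= uphalf_half oK.
Qed.

Lemma tail_majorant_start : tail_majorant p <= 1.
Proof.
rewrite /tail_majorant.
have A0 : 0 < a%:R :> R by rewrite ltr0n.
have pp : p%:R ^+ a <= (uphalf p).*2%:R ^+ a :> R.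
  by rewrite lerXn2r ?nnegrE// ler_nat; lia.
have P0 : 0 < p%:R ^+ a :> R by rewrite exprn_gt0// ltr0n.
rewrite ler_pdivrMr ?mul1r ?(lt_le_trans P0)//; apply: le_trans pp.
rewrite ler_pdivrMr ?mulr_gt0// exprS mulrC ler_pM2l//.
by rewrite -natrM ler_nat; lia.
Qed.

(** The majorant at [p] can equal [1] (when [p = 2]), so the strict inequality
    comes from the first odd number after [p]: the potential drops strictly
    there, and never increases afterwards. *)
Lemma rough_zeta_lt_mighty : rough_zeta R r p < 1 + npow R r p.
Proof.
have p0 := npow_gt0 R r p isT.
set j := uphalf p; have pj : (p <= j.*2)%N by rewrite /j; lia.
have start : potential p <= 1 + npow R r p.
  rewrite /potential rough_sum_small ?leqnn// lerD2l -[leRHS]mulr1.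
  by rewrite ler_pM2l// tail_majorant_start.
have lej : potential j.*2 <= potential p by apply: potential_le; rewrite leqnn.
apply: le_lt_trans (lt_le_trans (potentialS_lt j pj) (le_trans lej start)).
apply: rough_zeta_le => N.
pose K := maxn N j.*2.+1.
apply: le_trans (rough_sum_le R r p N K (leq_maxl _ _)) _.
apply: le_trans (potential_le j.*2.+1 K _); last by rewrite leq_maxr leqW.
rewrite /potential lerDl mulr_ge0 ?(ltW p0)//.
by rewrite /tail_majorant !divr_ge0 ?mulr_ge0 ?exprn_ge0.
Qed.

End Mighty.

(** * Mighty primes and components *)

Section Main.
Variables (R : realType) (r : R).
Hypothesis r1 : 1 < r.

Lemma mightyE (p : nat) :
  mighty r p <-> prime p /\ rough_zeta R r p < 1 + npow R r p.
Proof.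
split=> [[m [m0 -> lt]]|[pp lt]].
  by split; [exact: prime_nth_prime | rewrite -euler_product].
have [m m0 mp] := nth_prime_onto p pp.
by exists m; split=> //; rewrite euler_product// mp.
Qed.

Let sigma_range : set R := [set sigmaN r n | n in [set n | (0 < n)%N]].
Let component_of (n : nat) : set R :=
  connected_component (closure sigma_range) (sigmaN r n).

Lemma closure_sigma_range (n : nat) : (0 < n)%N ->
  closure sigma_range (sigmaN r n).
Proof. by move=> n0; apply: subset_closure; exists n. Qed.

(** The gap of [p] lies between [sigma n] and [sigma p]. *)
Lemma mighty_component_neq (p n : nat) : mighty r p -> (0 < n)%N -> rough p n ->
  component_of n <> component_of p.
Proof.
move=> /mightyE[pp lt] n0 rn.
apply: (component_gap R sigma_range _ _ _ _ _ lt).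
- exact: sigmaN_rough_le.
- by apply: sigmaN_ge; rewrite ?prime_gt0.
- by apply: closure_sigma_range; exact: prime_gt0.
- by move=> _ [k k0 <-]; exact: sigmaN_gap.
Qed.

(** The larger of two distinct elements of this set is a prime, and the smaller
    one is either [1] or a mighty prime.  If it is [1], the gap of the larger
    one separates; otherwise the gap of the smaller one does. *)
Lemma mighty_component_inj :
  {in (1%N |` [set p | mighty r p])%classic &, injective component_of}.
Proof.
suff lt_neq p q : (1%N |` [set p | mighty r p])%classic p ->
    (1%N |` [set p | mighty r p])%classic q -> (p < q)%N ->
    component_of p <> component_of q.
  move=> p q /set_mem Mp /set_mem Mq e.
  by case: (ltngtP p q) => // pq; case: (lt_neq _ _ _ _ pq).
move=> [->|Mp] [->|Mq] pq //.
- exact: mighty_component_neq.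
- by have /mightyE[/prime_gt1] := Mp; lia.
- move/esym; apply: mighty_component_neq => //; first by lia.
  by have /mightyE[pq' _] := Mq; rewrite rough_prime.
Qed.

Lemma num_components_ge : (num_mighty r + 1 <= num_components r)%E.
Proof.
have n1 : ~ [set p | mighty r p]%classic 1%N by move=> /mightyE[].
rewrite /num_mighty -(counting_add1 _ _ _ _ n1); apply: counting_card_le.
rewrite -(card_le_eql (inj_card_eq mighty_component_inj)).
apply: subset_card_le => _ [p Mp <-].
exists (sigmaN r p) => //; apply: closure_sigma_range.
by case: Mp => [->//|/mightyE[/prime_gt0]].
Qed.

Lemma mighty_le (p : nat) : prime p -> p%:R <= r -> mighty r p.
Proof.
case: p => // a pp ar; apply/mightyE; split=> //.
by apply: rough_zeta_lt_mighty => //; exact: prime_gt1 pp.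
Qed.

Lemma num_mighty_ge : (prime_pi r <= num_mighty r)%E.
Proof.
apply: counting_card_le; apply: subset_card_le => p [pp pr].
exact: mighty_le.
Qed.

End Main.

Theorem theorem3p1 (R : realType) (r : R) (hr : 1 < r) :
  (num_components r >= num_mighty r + 1)%E /\
  (num_mighty r + 1 >= prime_pi r + 1)%E.
Proof.
split; first exact: num_components_ge.
by rewrite leeD2r// num_mighty_ge.
Qed.
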